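(* Let $M=G/K$ be a Riemannian symmetric space of compact type with decomposition $\mathfrak g=\mathfrak k\oplus\mathfrak m$, let $\mathfrak m'\subset\mathfrak m$ be a Lie triple system, and let $\mathfrak a$ be a Cartan subalgebra of $\mathfrak m$ such that $\mathfrak a':=\mathfrak a\cap\mathfrak m'$ is a Cartan subalgebra of $\mathfrak m'$. Let $\alpha\in\Delta(\mathfrak m',\mathfrak a')$. (a) If $\alpha$ is elementary and $\lambda\in\Delta(\mathfrak m,\mathfrak a)$ is the unique root with $\lambda|_{\mathfrak a'}=\alpha$, then $\lambda^\sharp\in\mathfrak a'$. (b) If $\alpha$ is composite and $\lambda,\mu\in\Delta(\mathfrak m,\mathfrak a)$ are two different roots with $\lambda|_{\mathfrak a'}=\alpha=\mu|_{\mathfrak a'}$, then $\lambda^\sharp-\mu^\sharp$ is orthogonal to $\mathfrak a'$.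
   Context: $M=G/K$ is a Riemannian symmetric space of compact type, $\mathfrak g=\mathfrak k\oplus\mathfrak m$ is the decomposition of the Lie algebra of $G$ induced by the symmetric structure; the Killing form $\varkappa$ of $\mathfrak g$ is negative definite, and $\langle\cdot,\cdot\rangle=-c\,\varkappa$ for some fixed $c>0$. A linear subspace $\mathfrak m'\subset\mathfrak m$ is a Lie triple system if $[[\mathfrak m',\mathfrak m'],\mathfrak m']\subset\mathfrak m'$. A linear subspace $\mathfrak a$ is flat if $[\mathfrak a,\mathfrak a]=\{0\}$. For $\mathfrak m$ (and likewise for a Lie triple system $\mathfrak m'$), the rank is the maximal dimension of a flat subspace contained in it, and a Cartan subalgebra is a flat subspace of it whose dimension equals the rank. For a Cartan subalgebra $\mathfrak a\subset\mathfrak m$ and $\lambda\in\mathfrak a^*$ put $\mathfrak m_\lambda=\{X\in\mathfrak m\mid\forall Z\in\mathfrak a:\ \mathrm{ad}(Z)^2X=-\lambda(Z)^2X\}$ and $\Delta(\mathfrak m,\mathfrak a)=\{\lambda\in\mathfrak a^*\setminus\{0\}\mid\mathfrak m_\lambda\ne\{0\}\}$. For a Cartan subalgebra $\mathfrak a'$ of the Lie triple system $\mathfrak m'$ and $\alpha\in(\mathfrak a')^*$ put $\mathfrak m'_\alpha=\{X\in\mathfrak m'\mid\forall Z\in\mathfrak a':\ \mathrm{ad}(Z)^2X=-\alpha(Z)^2X\}$. The Lie triple system decomposes as $\mathfrak m'=\mathfrak m'_{fl}\oplus\mathfrak m'_c$ into Lie triple systems with $\mathfrak m'_{fl}$ flat,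 $[\mathfrak m',\mathfrak m'_{fl}]=\{0\}$ and $\mathfrak m'_c$ of compact type, and $\mathfrak a'=\mathfrak m'_{fl}\oplus\mathfrak a'_c$ with a Cartan subalgebra $\mathfrak a'_c$ of $\mathfrak m'_c$; $\Delta(\mathfrak m',\mathfrak a')$ is the set of those $\alpha\in(\mathfrak a')^*$ with $\alpha|_{\mathfrak m'_{fl}}=0$ whose restriction to $\mathfrak a'_c$ is a root of $\mathfrak m'_c$ with respect to $\mathfrak a'_c$; equivalently $\Delta(\mathfrak m',\mathfrak a')=\{\alpha\in(\mathfrak a')^*\setminus\{0\}\mid\mathfrak m'_\alpha\neq\{0\}\}$. With $\mathfrak a'=\mathfrak a\cap\mathfrak m'$, for every $\alpha\in\Delta(\mathfrak m',\mathfrak a')$ there is at least one $\lambda\in\Delta(\mathfrak m,\mathfrak a)$ with $\lambda|_{\mathfrak a'}=\alpha$. The root $\alpha$ is called elementary if there is only one such $\lambda$, and composite if there are at least two different such roots. For $\lambda\in\mathfrak a^*$, $\lambda^\sharp\in\mathfrak a$ is the Riesz vector, characterized by $\langle\cdot,\lambda^\sharp\rangle=\lambda$. *)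

(* Defs.v *)
From HB Require Import structures.
From mathcomp Require Import all_boot all_order all_algebra.
From mathcomp Require Import boolp classical_sets reals.

Set Implicit Arguments.
Unset Strict Implicit.
Unset Printing Implicit Defensive.
Import Order.TTheory GRing.Theory Num.Theory.

Local Open Scope classical_set_scope.
Local Open Scope ring_scope.

HB.mixin Record Vector_isLie (R : fieldType) (g : Type) of Vector R g := {
  lie : g -> g -> g;
  lie_linearl : forall y, linear (fun x => lie x y);
  lie_linearr : forall x, linear (lie x);
  liexx : forall x, lie x x = 0;
  lie_jacobi : forall x y z,
    lie x (lie y z) + lie y (lie z x) + lie z (lie x y) = 0 }.

(* Finite-dimensional, since the underlying module is a vectType. *)
#[short(type="lieAlgType")]
HB.structure Definition LieAlg (R : fieldType) :=
  { g of Vector_isLie R g & Vector R g }.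

HB.instance Definition _ (R : fieldType) (g : lieAlgType R) (x : g) :=
  GRing.isLinear.Build R g g _ (lie x) (lie_linearr x).

Section LieAlgebra.
Variables (R : fieldType) (g : lieAlgType R).
Implicit Types (x y z : g) (a m : {vspace g}).

Definition ad x : 'End(g) := linfun (lie x).

Lemma adE x y : ad x y = lie x y.
Proof. by rewrite lfunE. Qed.

Definition lftrace (f : 'End(g)) : R :=
  \tr (passmx.mxof (vbasis {:g}) (vbasis {:g}) f).

Definition killing x y : R := lftrace (ad x \o ad y)%VF.

(* The infinitesimal data of a symmetric space G/K: the differential sigma of
   the involution of G, and its eigenspaces k (for 1) and m (for -1). *)
Record symmetric_decomposition (sigma : 'End(g)) (k m : {vspace g}) : Prop :=
  SymmetricDecomposition {
    symm_lie : forall x y, sigma (lie x y) = lie (sigma x) (sigma y);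
    symm_invol : (sigma \o sigma)%VF = \1%VF;
    symm_k : k = passmx.leigenspace sigma 1;
    symm_m : m = passmx.leigenspace sigma (-1) }.

Definition lie_triple_system m : Prop :=
  forall x y z, x \in m -> y \in m -> z \in m -> lie (lie x y) z \in m.

Definition flat_subspace a : Prop :=
  forall x y, x \in a -> y \in a -> lie x y = 0.

Definition lts_rank m : nat :=
  \max_(d < (\dim m).+1 |
        `[< exists a, [/\ (a <= m)%VS, flat_subspace a & \dim a = d] >]) d.

Definition cartan_subalgebra m a : Prop :=
  [/\ (a <= m)%VS, flat_subspace a & \dim a = lts_rank m].

Definition dual_space a := 'Hom(subvs_of a, R^o).

(* The restriction to b of a linear form on a; meaningful when b <= a. *)
Definition restrict_form a b (lambda : dual_space a) : dual_space b :=
  linfun (fun Z : subvs_of b => lambda (vsproj a (vsval Z))).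

Lemma restrict_formE a b (lambda : dual_space a) (Z : subvs_of b) :
  restrict_form b lambda Z = lambda (vsproj a (vsval Z)).
Proof.
pose f := fun W : subvs_of b => lambda (vsproj a (vsval W)).
have f_lin : linear f by move=> t u v; rewrite /f !linearP.
pose fM := GRing.isLinear.Build R _ _ _ f f_lin.
pose fL : {linear _ -> _} := HB.pack f fM.
exact: (lfunE fL).
Qed.

Definition root_space m a (lambda : dual_space a) : set g :=
  [set X | X \in m /\ forall Z : subvs_of a,
           ad (vsval Z) (ad (vsval Z) X) = - ((lambda Z : R) ^+ 2) *: X].

Definition lts_roots m a : set (dual_space a) :=
  [set lambda | lambda <> 0 /\ root_space m lambda <> [set 0]].
Arguments lts_roots : clear implicits.

(* In the next two definitions b is a subspace of the Cartan subalgebra a of m,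
   and alpha is a linear form on b. *)
Definition elementary_root m a b (alpha : dual_space b) : Prop :=
  exists! lambda : dual_space a,
    lambda \in lts_roots m a /\ restrict_form b lambda = alpha.

Definition composite_root m a b (alpha : dual_space b) : Prop :=
  exists lambda mu : dual_space a,
    [/\ lambda \in lts_roots m a /\ restrict_form b lambda = alpha,
        mu \in lts_roots m a /\ restrict_form b mu = alpha & lambda <> mu].

Lemma root_spaceP m a (lambda : dual_space a) :
  root_space m lambda <> [set 0] <->
  exists2 X : g, X != 0 & root_space m lambda X.
Proof.
split=> [ne0|[X X0 mX] eq0]; last by move: mX X0; rewrite eq0 => ->; rewrite eqxx.
apply: contrapT => noX; apply: ne0; rewrite eqEsubset; split=> X /= mX.
  by apply: contrapT => /eqP X0; apply: noX; exists X.
by rewrite mX; split=> [|Z]; [exact: mem0v | rewrite !linear0].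
Qed.

(* A Lie triple system m in general has a flat central factor fl besides a
   factor c of compact type; lts_roots then agrees with the definition of roots
   through the factors: alpha vanishes on fl and restricts to a root of c. *)
Lemma roots_flat_factor m fl c a ac (alpha : dual_space a) :
    lie_triple_system c -> (fl + c)%VS = m ->
    (forall x y, x \in m -> y \in fl -> lie x y = 0) ->
    (ac <= c)%VS -> (fl + ac)%VS = a ->
  alpha \in lts_roots m a <->
  (forall Z, Z \in fl -> alpha (vsproj a Z) = 0) /\
  restrict_form ac alpha \in lts_roots c ac.
Proof.
move=> ltsc defm cent acc defa.
have flm : (fl <= m)%VS by rewrite -defm addvSl.
have cm : (c <= m)%VS by rewrite -defm addvSr.
have fla : (fl <= a)%VS by rewrite -defa addvSl.
have aca : (ac <= a)%VS by rewrite -defa addvSr.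
have Dl (u v w : g) : lie (u + v) w = lie u w + lie v w.
  by have := lie_linearl w 1 u v; rewrite !scale1r.
have lieC x y : lie x y = - lie y x.
  apply/eqP; rewrite -subr_eq0 opprK; apply/eqP.
  by have := liexx (x + y); rewrite Dl !linearD /= !liexx add0r addr0.
have centl x y : x \in fl -> y \in m -> lie x y = 0.
  by move=> fx my; rewrite lieC cent ?oppr0.
have sqc Z X : Z \in c -> X \in c -> lie Z (lie Z X) \in c.
  by move=> cZ cX; rewrite (lieC Z (lie Z X)) rpredN ltsc.
rewrite !inE; split=> [[al0 /root_spaceP[X X0 [mX XZ]]]|].
  have alfl Z : Z \in fl -> alpha (vsproj a Z) = 0.
    move=> fZ; have aZ : Z \in a by apply: (subvP fla).
    have := XZ (vsproj a Z); rewrite !adE vsprojK//.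
    rewrite (centl _ X)// linear0 => /esym/eqP.
    by rewrite scaler_eq0 (negPf X0) orbF oppr_eq0 sqrf_eq0 => /eqP.
  split=> //.
  have r0 : restrict_form ac alpha <> 0.
    move=> r0; apply: al0; apply/lfunP => Z.
    have : vsval Z \in (fl + ac)%VS by rewrite defa subvsP.
    case/memv_addP=> u fu [v av eZ].
    rewrite -(vsvalK Z) eZ linearD/= linearD/= alfl// add0r.
    by have /lfunP/(_ (vsproj ac v)) := r0; rewrite restrict_formE vsprojK// !lfunE.
  split=> //; apply/root_spaceP; exists X => //.
  have [Z rZ] : exists Z, restrict_form ac alpha Z != 0.
    apply: contrapT => no; apply: r0; apply/lfunP => Z.
    by rewrite [RHS]lfunE /=; apply: contrapT => /eqP h; apply: no; exists Z.
  have XZ' (W : subvs_of ac) :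
      ad (vsval W) (ad (vsval W) X) = - ((restrict_form ac alpha W : R) ^+ 2) *: X.
    have aW : vsval W \in a by apply: (subvP aca); apply: subvsP.
    by have := XZ (vsproj a (vsval W)); rewrite vsprojK// restrict_formE.
  split=> //; have : X \in (fl + c)%VS by rewrite defm.
  case/memv_addP=> u fu [v cv eX].
  have cZ : vsval Z \in c by apply: (subvP acc); apply: subvsP.
  have := XZ' Z; rewrite !adE {1}eX linearD /= [lie _ u]cent ?(subvP cm)//.
  rewrite add0r => e.
  have := sqc _ _ cZ cv; rewrite e rpredZeq oppr_eq0 sqrf_eq0.
  by rewrite (negPf rZ).
case=> alfl [r0 /root_spaceP[X X0 [cX XZ]]]; split.
  by move=> al0; apply: r0; apply/lfunP=> Z; rewrite restrict_formE al0 !lfunE.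
apply/root_spaceP; exists X => //; split=> [|Z]; first exact: (subvP cm).
have : vsval Z \in (fl + ac)%VS by rewrite defa subvsP.
case/memv_addP=> u fu [v av eZ].
have cv : v \in c by apply: (subvP acc).
have uX : lie u X = 0 by rewrite centl ?(subvP cm).
have uvX : lie u (lie v X) = 0.
  have := lie_jacobi u v X.
  rewrite (lieC X u) uX oppr0 linear0 addr0.
  by rewrite (centl u v) ?(subvP cm)// linear0 addr0.
have -> : alpha Z = restrict_form ac alpha (vsproj ac v).
  rewrite restrict_formE vsprojK// -[in LHS](vsvalK Z) eZ.
  by rewrite linearD/= linearD/= alfl// add0r.
by rewrite -XZ !adE vsprojK// eZ !Dl uX add0r uvX add0r.
Qed.

End LieAlgebra.

Arguments lts_roots {R g} m a.

Section CompactType.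
Variables (R : realType) (g : lieAlgType R).
Implicit Types (x y : g) (a : {vspace g}).

Definition killing_negative_definite : Prop :=
  forall x, x != 0 -> killing x x < 0.

Definition inner_form (c : R) x y : R := - c * killing x y.

(* The Riesz vector of lambda in a; it exists and is unique as soon as
   inner_form c is definite, and the default value 0 is then never used. *)
Definition riesz (c : R) a (lambda : dual_space a) : g :=
  xget 0 [set v | v \in a /\
                  forall Z : subvs_of a, inner_form c (vsval Z) v = lambda Z].

End CompactType.

Arguments killing_negative_definite {R} g.

(* Main.v *)
From HB Require Import structures.
Require Import Defs.
From mathcomp Require Import all_boot all_order all_algebra.
From mathcomp Require Import boolp classical_sets reals.
From mathcomp Require Import complex ring.

Set Implicit Arguments.
Unset Strict Implicit.
Unset Printing Implicit Defensive.
Import Order.TTheory GRing.Theory Num.Theory.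

Local Open Scope classical_set_scope.
Local Open Scope ring_scope.

(** Part (b) only says that a Riesz vector pairs with a' through the
restriction of its form: lambda and mu have the same restriction, so their
Riesz vectors have the same inner products with a'. It rests on the existence
of Riesz vectors ([riesz_representation]).

For part (a), the idea is to exhibit the Riesz vector of lambda, up to a scalar,
as a triple bracket of elements of m', which is therefore in m'. Choose Z0 in a'
with alpha(Z0) <> 0 and a nonzero X in the root space m'_alpha.

- If X belongs to the root space m_lambda of the large system, then
  H = [X, [Z0, X]] commutes with every Z in a: [Z, X] is proportional to
  [Z0, X], and [Z, [Z0, X]] is proportional to X, so both terms of the Leibniz
  rule vanish. A Cartan subalgebra is its own centralizer in m
  ([cartan_subalgebra_maximal]), so H lies in a. Invariance of the Killing form
  gives <Z, H> = lambda(Z) |[Z0, X]|^2 / lambda(Z0), so H is a multiple of the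
  Riesz vector ([riesz_bracket]). As H is also in m', the Riesz vector is in a'.

- It remains to see that X is in m_lambda ([elementary_root_space]); this is
  where elementarity enters. The operators S_Z = - ad(Z) ad(Z0) / alpha(Z0), for
  Z in a, commute, are self-adjoint and depend linearly on Z. They preserve the
  subspace V of those x in m with S_W x = alpha(W) x for all W in a', and V
  contains m'_alpha. On a joint eigenvector in V, the eigenvalue mu(Z) of S_Z is
  linear in Z, and mu is a root of m that restricts to alpha; hence mu = lambda.
  By simultaneous diagonalization ([commuting_selfadjoint_scalar]), S_Z acts on
  all of V as lambda(Z), which puts V inside m_lambda.

  Working with the products ad(Z) ad(Z0) instead of the squares ad(Z)^2 makes
  the eigenvalues linear forms at once, with no sign to choose. *)

(** * Linear algebra of commuting self-adjoint operators *)

(** The family may be infinite: as dimensions decrease, finitely many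
intersections with kernels reach the common kernel. *)
Lemma common_kernel (F : fieldType) (V : vectType F) I (T : I -> 'End(V))
    (U : {vspace V}) :
  exists W : {vspace V}, forall x, x \in W <-> x \in U /\ forall i, T i x = 0.
Proof.
have [n] := ubnP (\dim U); elim: n U => // n IHn U; rewrite ltnS => dimU.
have [T0|/existsNP[i /existsNP[x /not_implyP[xU Tx]]]] :=
  pselect (forall i, {in U, forall x, T i x = 0}).
  by exists U => x; split=> [xU|[]//]; split=> // i; apply: T0.
have [|W WE] := IHn (U :&: lker (T i))%VS.
  apply: leq_trans dimU; rewrite ltn_neqAle dimvS ?capvSl // andbT.
  rewrite (dimv_leqif_sup (capvSl _ _)); apply/negP=> /subvP/(_ _ xU).
  by rewrite memv_cap memv_ker => /andP[_ /eqP].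
exists W => y; split=> [/WE[+ Ty]|[yU Ty]];
  first by rewrite memv_cap => /andP[].
by apply/WE; rewrite memv_cap yU memv_ker Ty eqxx.
Qed.

(** The real and imaginary parts of a complex eigenvector w = u + i v of A, with
eigenvalue x + i y, written as equations over the reals. *)
Lemma real_matrix_complex_eigenvector (R : rcfType) n (A : 'M[R]_n) :
  (0 < n)%N ->
  exists x y (u v : 'rV[R]_n),
    [/\ u *m A = x *: u - y *: v, v *m A = x *: v + y *: u
      & (u != 0) || (v != 0)].
Proof.
move=> n0; pose AC : 'M[R[i]]_n := map_mx (real_complex R) A.
have /closed_rootP[z] : size (char_poly AC) != 1%N.
  by rewrite size_char_poly; case: n n0 {A AC}.
rewrite -eigenvalue_root_char => /eigenvalueP[w wA w0].
have wE j : \sum_i w 0 i * (real_complex R (A i j)) = z * w 0 j.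
  have /matrixP/(_ 0 j) := wA; rewrite !mxE => <-.
  by apply: eq_bigr => i _; rewrite mxE.
have ReD p : complex.Re (\sum_i (p i : R[i])) = \sum_(i < n) complex.Re (p i).
  by elim/big_rec2: _ => // i x y _ <-; case: (p i) y => ? ? [].
have ImD p : complex.Im (\sum_i (p i : R[i])) = \sum_(i < n) complex.Im (p i).
  by elim/big_rec2: _ => // i x y _ <-; case: (p i) y => ? ? [].
exists (complex.Re z), (complex.Im z), (map_mx (@complex.Re R) w),
  (map_mx (@complex.Im R) w); split.
- apply/rowP=> j; rewrite !mxE.
  transitivity (complex.Re (z * w 0 j)); last first.
    by case: (z) => ? ?; case: (w 0 j) => ? ?.
  rewrite -wE ReD; apply: eq_bigr => i _; rewrite mxE.
  by case: (w 0 i) => a b /=; rewrite mulr0 subr0.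
- apply/rowP=> j; rewrite !mxE.
  transitivity (complex.Im (z * w 0 j)); last first.
    by case: (z) => ? ?; case: (w 0 j) => ? ?.
  rewrite -wE ImD; apply: eq_bigr => i _; rewrite mxE.
  by case: (w 0 i) => a b /=; rewrite mulr0 add0r.
- apply: contraNT w0; rewrite negb_or !negbK => /andP[/eqP u0 /eqP v0].
  apply/eqP/rowP=> j; have /rowP/(_ j) := u0; have /rowP/(_ j) := v0.
  by rewrite !mxE; case: (w 0 j) => a b /= -> ->.
Qed.

Section InnerProduct.
Variables (R : rcfType) (V : vectType R) (B : V -> V -> R).
Hypothesis B_linear : forall t x y z, B (t *: x + y) z = t * B x z + B y z.
Hypothesis B_sym : forall x y, B x y = B y x.
Hypothesis B_pos : forall x, x != 0 -> 0 < B x x.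

Lemma form0l z : B 0 z = 0.
Proof. by have := B_linear (-1) 0 0 z; rewrite scaler0 add0r mulN1r addNr. Qed.

Lemma formDl x y z : B (x + y) z = B x z + B y z.
Proof. by have := B_linear 1 x y z; rewrite scale1r mul1r. Qed.

Lemma formZl t x z : B (t *: x) z = t * B x z.
Proof. by have := B_linear t x 0 z; rewrite form0l !addr0. Qed.

Lemma form_suml I r (P : pred I) (F : I -> V) z :
  B (\sum_(i <- r | P i) F i) z = \sum_(i <- r | P i) B (F i) z.
Proof. exact: (big_morph (B^~ z) (fun x y => formDl x y z) (form0l z)). Qed.

Lemma form_eq0 x : B x x = 0 -> x = 0.
Proof. by move=> Bx; apply/eqP; apply: contra_eqT Bx => /B_pos/lt0r_neq0. Qed.

(** The Gram matrix of a basis of a is invertible because the form is definite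
on a; solving the corresponding linear system gives the coordinates of the Riesz
vector. *)
Lemma riesz_representation (a : {vspace V}) (l : 'Hom(subvs_of a, R^o)) :
  exists2 v, v \in a & forall Z, B (vsval Z) v = l Z.
Proof.
set n := \dim a; pose e := vbasis a.
have ea (i : 'I_n) : e`_i \in a by rewrite vbasis_mem ?mem_nth ?size_tuple.
pose G : 'M[R]_n := \matrix_(i, j) B e`_i e`_j.
have comb_in (u : 'rV[R]_n) : \sum_i u 0 i *: e`_i \in a.
  by apply: rpred_sum => i _; rewrite rpredZ.
have GE (u : 'rV[R]_n) j : (u *m G) 0 j = B (\sum_i u 0 i *: e`_i) e`_j.
  by rewrite form_suml mxE; apply: eq_bigr => i _; rewrite formZl mxE.
have Bcomb (u w : 'rV[R]_n) : B (\sum_i w 0 i *: e`_i) (\sum_i u 0 i *: e`_i)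
    = \sum_j w 0 j * (u *m G) 0 j.
  by rewrite form_suml; apply: eq_bigr => j _; rewrite formZl B_sym GE.
have Gfree : row_free G.
  apply: inj_row_free => u uG0.
  have /form_eq0 u0 :
      B (\sum_i u 0 i *: e`_i) (\sum_i u 0 i *: e`_i) = 0.
    by rewrite Bcomb uG0 big1 // => j _; rewrite mxE mulr0.
  have /freeP/(_ _ u0) u_eq0 := basis_free (vbasisP a).
  by apply/rowP=> j; rewrite mxE u_eq0.
pose w : 'rV[R]_n := \row_j l (vsproj a e`_j).
exists (\sum_i (w *m invmx G) 0 i *: e`_i) => // Z.
have eZ := coord_vbasis (subvsP Z).
pose z : 'rV[R]_n := \row_j coord e j (vsval Z).
have {}eZ : vsval Z = \sum_i z 0 i *: e`_i.
  by rewrite {1}eZ; apply: eq_bigr => i _; rewrite mxE.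
rewrite {1}eZ Bcomb mulmxKV -?row_free_unit // -[Z in RHS]vsvalK eZ.
rewrite !linear_sum; apply: eq_bigr => j _; rewrite !linearZ.
by congr (_ * _); rewrite mxE.
Qed.

(** If u + i v is a complex eigenvector for x + i y, comparing B (f u) v with
B u (f v) gives y (B u u + B v v) = 0. So y = 0, and whichever of u and v is
nonzero is a real eigenvector. *)
Lemma selfadjoint_eigenvector (f : 'End(V)) (U : {vspace V}) :
  (f @: U <= U)%VS -> (forall x y, B (f x) y = B x (f y)) -> U != 0%VS ->
  exists t v, [/\ v \in U, v != 0 & f v = t *: v].
Proof.
move=> fU f_sym U0; set n := \dim U; pose e := vbasis U.
have n0 : (0 < n)%N by rewrite lt0n dimv_eq0.
have eU (i : 'I_n) : e`_i \in U by rewrite vbasis_mem ?mem_nth ?size_tuple.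
pose A : 'M[R]_n := \matrix_(i, j) coord e j (f e`_i).
pose comb (u : 'rV[R]_n) := \sum_i u 0 i *: e`_i.
have combU u : comb u \in U by apply: rpred_sum => i _; rewrite rpredZ.
have combL t u v : comb (t *: u + v) = t *: comb u + comb v.
  rewrite /comb scaler_sumr -big_split; apply: eq_bigr => i _ /=.
  by rewrite !mxE scalerDl scalerA.
have comb_inj u : comb u = 0 -> u = 0.
  move=> u0; have /freeP/(_ _ u0) u_eq0 := basis_free (vbasisP U).
  by apply/rowP=> j; rewrite mxE u_eq0.
have f_comb u : f (comb u) = comb (u *m A).
  rewrite linear_sum /comb.
  under [RHS]eq_bigr do rewrite mxE scaler_suml.
  rewrite exchange_big; apply: eq_bigr => i _ /=; rewrite linearZ /=.
  have /coord_vbasis -> : f e`_i \in U by apply: (subvP fU); rewrite memv_img.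
  by rewrite scaler_sumr; apply: eq_bigr => j _; rewrite mxE scalerA.
have [x [y [u [v [uA vA uv0]]]]] := real_matrix_complex_eigenvector A n0.
have combZ t w : comb (t *: w) = t *: comb w.
  by rewrite /comb scaler_sumr; apply: eq_bigr => i _; rewrite mxE scalerA.
have fu : f (comb u) = x *: comb u - y *: comb v.
  by rewrite f_comb uA combL -scaleNr combZ scaleNr.
have fv : f (comb v) = x *: comb v + y *: comb u.
  by rewrite f_comb vA combL combZ.
have Bge0 z : 0 <= B z z.
  by have [->|/B_pos/ltW//] := eqVneq z 0; rewrite form0l.
have comb_neq0 w : w != 0 -> comb w != 0.
  by apply: contra_neq => /comb_inj.
have : y * (B (comb u) (comb u) + B (comb v) (comb v)) = 0.
  have := f_sym (comb u) (comb v); rewrite fu fv [RHS]B_sym -!scaleNr.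
  rewrite ![x *: _ + _]addrC !formDl !formZl [B (comb v) (comb u)]B_sym.
  move=> e1; rewrite mulrDr; move/eqP: e1.
  by rewrite (inj_eq (addIr _)) mulNr eq_sym -subr_eq0 opprK => /eqP.
have s0 : B (comb u) (comb u) + B (comb v) (comb v) != 0.
  rewrite paddr_eq0 // negb_and.
  by case/orP: uv0 => /comb_neq0/B_pos/lt0r_neq0 ->; rewrite ?orbT.
move/eqP; rewrite mulf_eq0 (negPf s0) orbF => /eqP y0.
rewrite y0 !scale0r subr0 in fu; rewrite y0 !scale0r addr0 in fv.
case/orP: uv0 => /comb_neq0 w0; first by exists x, (comb u).
by exists x, (comb v).
Qed.

Section CommutingFamily.
Variables (I : Type) (F : I -> 'End(V)).
Hypothesis F_comm : forall i j x, F i (F j x) = F j (F i x).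
Hypothesis F_sym : forall i x y, B (F i x) y = B x (F i y).

(** Either every operator is scalar on U, and any vector will do, or an
eigenspace of some operator in U is a smaller nonzero subspace; it is stable
under the others because they commute. *)
Lemma commuting_selfadjoint_eigenvector (U : {vspace V}) :
  (forall i, (F i @: U <= U)%VS) -> U != 0%VS ->
  exists v, [/\ v \in U, v != 0 & forall i, exists t, F i v = t *: v].
Proof.
have [n] := ubnP (\dim U); elim: n U => // n IHn U; rewrite ltnS => dimU FU U0.
have [scal|] := pselect (forall i, exists t, {in U, forall v, F i v = t *: v}).
  exists (vpick U); split; rewrite ?memv_pick ?vpick0 // => i.
  by have [t Ft] := scal i; exists t; rewrite Ft ?memv_pick.
move=> /existsNP[i /forallNP nscal].
have [t [v [vU v0 fv]]] := selfadjoint_eigenvector (FU i) (F_sym i) U0.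
pose E := (U :&: lker (F i - t *: \1%VF))%VS.
have memE x : (x \in E) = (x \in U) && (F i x == t *: x).
  by rewrite memv_cap memv_ker !lfun_simp subr_eq0.
have sEU : (E <= U)%VS by apply: capvSl.
have [w [wE w0 wF]] : exists v, [/\ v \in E, v != 0
    & forall i, exists t, F i v = t *: v].
  apply: IHn => [|j|]; last 1 first.
  - by apply: contra_neq v0 => E0; apply/eqP; rewrite -memv0 -E0 memE vU fv /=.
  - apply: leq_trans dimU; rewrite ltn_neqAle dimvS // andbT.
    apply/negP; rewrite (dimv_leqif_sup sEU) => sUE.
    apply: (nscal t) => x xU; apply/eqP.
    by have := subvP sUE _ xU; rewrite memE => /andP[].
  - apply/subvP=> _ /memv_imgP[x + ->]; rewrite !memE => /andP[xU /eqP Fx].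
    by rewrite (subvP (FU j)) ?memv_img // F_comm Fx linearZ /=.
by exists w; rewrite (subvP sEU).
Qed.

(** A form of simultaneous diagonalization: if l i is the only joint eigenvalue
in U, then F i acts on U as l i. Otherwise the image of F i - l i is a nonzero
stable subspace, hence contains a joint eigenvector; by assumption it lies in
the kernel of F i - l i, which is orthogonal to the image. *)
Lemma commuting_selfadjoint_scalar (U : {vspace V}) (l : I -> R) :
  (forall i, (F i @: U <= U)%VS) ->
  (forall v, v \in U -> v != 0 -> (forall i, exists t, F i v = t *: v) ->
     forall i, F i v = l i *: v) ->
  forall i u, u \in U -> F i u = l i *: u.
Proof.
move=> FU only_l i u uU; apply/eqP; rewrite -subr_eq0.
pose T := F i - l i *: \1%VF.
have TE x : T x = F i x - l i *: x by rewrite !lfun_simp.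
rewrite -TE -memv0; suff <- : (T @: U)%VS = 0%VS by apply: memv_img.
apply/eqP; apply: contraT => W0.
have WU : (T @: U <= U)%VS.
  apply/subvP=> _ /memv_imgP[x xU ->].
  by rewrite TE rpredB ?rpredZ // (subvP (FU i)) ?memv_img.
have FW j : (F j @: (T @: U) <= T @: U)%VS.
  apply/subvP=> _ /memv_imgP[_ /memv_imgP[x xU ->] ->].
  suff -> : F j (T x) = T (F j x)
    by rewrite memv_img // (subvP (FU j)) ?memv_img.
  by rewrite !TE linearB linearZ /= F_comm.
have [v [/[dup] /memv_imgP[x xU vE] vW v0 vF]] :=
  commuting_selfadjoint_eigenvector FW W0.
have Fv := only_l v (subvP WU _ vW) v0 vF i.
have : B v v = 0.
  rewrite {1}vE TE -scaleNr formDl formZl F_sym Fv B_sym formZl [B v x]B_sym.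
  by rewrite mulNr subrr.
by move/form_eq0/eqP; rewrite (negPf v0).
Qed.

End CommutingFamily.
End InnerProduct.

(** * Killing form and Cartan subalgebras *)
Section Lie.
Variables (R : fieldType) (g : lieAlgType R).
Implicit Types (x y z : g) (a m : {vspace g}).

Lemma lieDl x y z : lie (x + y) z = lie x z + lie y z.
Proof. by have := lie_linearl z 1 x y; rewrite !scale1r. Qed.

Lemma lieZl t x z : lie (t *: x) z = t *: lie x z.
Proof.
have lie0l : lie 0 z = 0.
  by have := lie_linearl z (-1) 0 0; rewrite scaler0 addr0 scaleN1r addNr.
by have := lie_linearl z t x 0; rewrite lie0l !addr0.
Qed.

Lemma lieNl x z : lie (- x) z = - lie x z.
Proof. by rewrite -scaleN1r lieZl scaleN1r. Qed.

Lemma lieC x y : lie x y = - lie y x.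
Proof.
apply/eqP; rewrite -subr_eq0 opprK; apply/eqP.
by have := liexx (x + y); rewrite lieDl !linearD /= !liexx add0r addr0.
Qed.

Lemma lie_derivation x y z :
  lie x (lie y z) = lie (lie x y) z + lie y (lie x z).
Proof.
have /eqP := lie_jacobi x y z; rewrite -addrA addr_eq0 => /eqP ->.
by rewrite (lieC z (lie x y)) (lieC z x) linearN /= opprD !opprK addrC.
Qed.

Lemma lie_commute x y z : lie x y = 0 -> lie x (lie y z) = lie y (lie x z).
Proof.
move=> xy0; rewrite lie_derivation xy0; have := lieZl 0 0 z.
by rewrite !scale0r => ->; rewrite add0r.
Qed.

Lemma lftrace_linear t (f h : 'End(g)) :
  lftrace (t *: f + h) = t * lftrace f + lftrace h.
Proof. by rewrite /lftrace passmx.mxof_linear linearD linearZ. Qed.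

Lemma lftrace_comp (f h : 'End(g)) : lftrace (f \o h)%VF = lftrace (h \o f)%VF.
Proof.
have b := vbasisP {:g}.
by rewrite /lftrace !(passmx.mxof_comp _ _ b) mxtrace_mulC.
Qed.

Lemma killing_sym x y : killing x y = killing y x.
Proof. exact: lftrace_comp. Qed.

Lemma killing_linear t x y z :
  killing (t *: x + y) z = t * killing x z + killing y z.
Proof.
rewrite -lftrace_linear; congr lftrace; apply/lfunP=> w.
by rewrite !lfun_simp /= lieDl lieZl.
Qed.

(** Both sides expand, by ad [x, y] = [ad x, ad y], into traces of triple
products, which agree up to cyclic permutation. *)
Lemma killing_invariant x y z : killing (lie x y) z = - killing y (lie x z).
Proof.
have ad_lie (u v : g) :
    ad (lie u v) = -1 *: (ad v \o ad u)%VF + (ad u \o ad v)%VF.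
  apply/lfunP=> w; rewrite !lfun_simp /= (lie_derivation u v w) scaleN1r.
  by rewrite [X in - _ + X]addrC addKr.
rewrite /killing !ad_lie comp_lfunDl comp_lfunDr -comp_lfunZl -comp_lfunZr.
rewrite !lftrace_linear (lftrace_comp (ad y) (ad z \o ad x)%VF).
rewrite -!comp_lfunA (lftrace_comp (ad z)) -comp_lfunA.
ring.
Qed.

(** The involution acts by -1 on m, hence by (-1)^3 on a triple bracket. *)
Lemma symmetric_decomposition_lts sigma k m :
  symmetric_decomposition sigma k m -> lie_triple_system m.
Proof.
case=> sigma_lie _ _ ->.
have memE x : (x \in passmx.leigenspace sigma (-1)) = (sigma x == - x).
  by rewrite memv_ker !lfun_simp scaleN1r opprK addr_eq0.
move=> x y z; rewrite !memE !sigma_lie => /eqP-> /eqP-> /eqP->.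
by rewrite linearN /= lieNl linearN /= opprK.
Qed.

Lemma lts_lie2 m x y : lie_triple_system m -> x \in m -> y \in m ->
  forall z, z \in m -> lie x (lie y z) \in m.
Proof. by move=> lts xm ym z zm; rewrite lieC rpredN lts. Qed.

(** Otherwise adding x to a would give a flat subspace of m of dimension one
more than the rank. *)
Lemma cartan_subalgebra_maximal m a x :
  cartan_subalgebra m a -> x \in m -> (forall z, z \in a -> lie z x = 0) ->
  x \in a.
Proof.
move=> [am fa ra] xm xa; apply: contraT => xNa.
pose b := (a + <[x]>)%VS.
have bm : (b <= m)%VS by rewrite subv_add am -memvE.
have fb : flat_subspace b.
  move=> u v /memv_addP[u1 u1a [? /vlineP[s ->] ->]].
  move=> /memv_addP[v1 v1a [? /vlineP[t ->] ->]].
  rewrite lieDl !linearD !linearZ /= !lieZl (fa u1) // (xa u1) //.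
  by rewrite (lieC x) xa // liexx !(scaler0, oppr0, addr0).
have db : \dim b = (\dim a).+1.
  have x0 : x != 0 by apply: contraNneq xNa => ->; rewrite mem0v.
  rewrite dimv_disjoint_sum ?dim_vline ?x0 ?addn1 //.
  apply/eqP; rewrite -subv0; apply/subvP=> y /memv_capP[ya /vlineP[t yE]].
  move: ya; rewrite yE; have [->|t0] := eqVneq t 0;
    first by rewrite scale0r !mem0v.
  by rewrite rpredZeq (negPf t0) (negPf xNa).
have dm : (\dim b < (\dim m).+1)%N by rewrite ltnS dimvS.
suff : (\dim b <= lts_rank m)%N by rewrite db -ra ltnn.
rewrite /lts_rank (bigD1 (Ordinal dm)) ?leq_maxl //=.
by apply/asboolP; exists b.
Qed.

Lemma lts_rootsP m a (lambda : dual_space a) :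
  lambda \in lts_roots m a <->
  lambda <> 0 /\ exists2 X, X != 0 & root_space m lambda X.
Proof.
by rewrite inE; split=> [][l0 /root_spaceP rs]; split=> //; exact/root_spaceP.
Qed.

(** The condition on squares that defines a root space polarizes because ad Z
and ad W commute. *)
Lemma root_space_polarized m a (lambda : dual_space a) X (Z W : subvs_of a) :
  (2 : R) != 0 -> flat_subspace a -> root_space m lambda X ->
  lie (vsval Z) (lie (vsval W) X) = - ((lambda Z : R) * lambda W) *: X.
Proof.
move=> two0 fa [_ rX].
have sq V : lie (vsval V) (lie (vsval V) X) = - ((lambda V : R) ^+ 2) *: X.
  by rewrite -!adE rX.
have := sq (Z + W); rewrite !linearD /= !lieDl !linearD /= !sq.
have -> : lie (vsval W) (lie (vsval Z) X) = lie (vsval Z) (lie (vsval W) X).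
  by rewrite lie_commute // fa ?subvsP.
set T := lie _ (lie _ X) => e; apply: (scalerI two0).
have -> : 2 *: T = - ((lambda Z : R) ^+ 2) *: X + T
    + (T - ((lambda W : R) ^+ 2) *: X)
    + ((lambda Z : R) ^+ 2 + (lambda W : R) ^+ 2) *: X.
  by rewrite scalerDl scaleNr addrACA [- _ + T]addrC !subrK scaler_nat mulr2n.
rewrite -scaleNr e -scalerDl scalerA; congr (_ *: _); ring.
Qed.

Lemma dual_neq0 a (lambda : dual_space a) :
  lambda <> 0 -> exists Z, lambda Z != 0.
Proof.
move=> l0; apply: contrapT => no; apply: l0; apply/lfunP => Z.
by rewrite [RHS]lfunE; apply: contrapT => /eqP h; apply: no; exists Z.
Qed.

End Lie.

(** * Roots of a system of compact type *)

Section Compact.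
Variables (R : realType) (g : lieAlgType R) (c : R).
Hypotheses (compact : killing_negative_definite g) (c_gt0 : 0 < c).
Implicit Types (x y z : g) (m a : {vspace g}).
Local Notation B := (@inner_form R g c).

Lemma inner_form_linear t x y z : B (t *: x + y) z = t * B x z + B y z.
Proof. by rewrite /inner_form killing_linear; ring. Qed.

Lemma inner_form_sym x y : B x y = B y x.
Proof. by rewrite /inner_form killing_sym. Qed.

Lemma inner_form_gt0 x : x != 0 -> 0 < B x x.
Proof. by move=> /compact x0; rewrite /inner_form mulNr oppr_gt0 pmulr_rlt0. Qed.

Lemma inner_formZl t x z : B (t *: x) z = t * B x z.
Proof. exact: (formZl inner_form_linear). Qed.

Lemma inner_form_invariant x y z : B (lie x y) z = - B y (lie x z).
Proof. by rewrite /inner_form killing_invariant mulrN. Qed.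

Lemma rieszP a (lambda : dual_space a) :
  riesz c lambda \in a /\
  forall Z : subvs_of a, B (vsval Z) (riesz c lambda) = lambda Z.
Proof.
have [v va vE] := riesz_representation inner_form_linear inner_form_sym
  inner_form_gt0 lambda.
have := @xgetPex g 0 [set w | w \in a /\
  forall Z : subvs_of a, B (vsval Z) w = lambda Z].
by apply; exists v.
Qed.

Lemma riesz_unique a (lambda : dual_space a) v :
  v \in a -> (forall Z : subvs_of a, B (vsval Z) v = lambda Z) ->
  riesz c lambda = v.
Proof.
move=> va vE; have [ra rE] := rieszP lambda.
apply/eqP; rewrite -subr_eq0; apply/eqP.
apply: (form_eq0 inner_form_gt0).
set d := _ - v; have da : d \in a by rewrite rpredB.
have := rE (vsproj a d); rewrite -vE vsprojK // => e.
by rewrite {1}/d addrC -scaleN1r inner_form_linear [B v d]inner_form_sym -e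
  [B d _]inner_form_sym mulN1r addNr.
Qed.

(** A converse of [root_space_polarized] in which only one of the two arguments
varies: ad(Z0)^2 v is a nonzero multiple of v, so ad(Z)^2 v can be computed by
applying (ad(Z) ad(Z0))^2 to v. *)
Lemma root_space_of_polarized m a (lambda : dual_space a) (Z0 : subvs_of a) v :
  flat_subspace a -> lambda Z0 != 0 -> v \in m ->
  (forall Z : subvs_of a, lie (vsval Z) (lie (vsval Z0) v)
     = - ((lambda Z0 : R) * lambda Z) *: v) ->
  root_space m lambda v.
Proof.
move=> fa l0 vm vE; split=> // Z; rewrite !adE.
have l00 : (- ((lambda Z0 : R) * lambda Z0)) != 0 by rewrite oppr_eq0 mulf_neq0.
apply: (scalerI l00).
have -> : - ((lambda Z0 : R) * lambda Z0) *: lie (vsval Z) (lie (vsval Z) v)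
    = lie (vsval Z) (lie (vsval Z) (lie (vsval Z0) (lie (vsval Z0) v))).
  by rewrite vE !linearZ.
have -> : lie (vsval Z) (lie (vsval Z0) (lie (vsval Z0) v))
    = lie (vsval Z0) (lie (vsval Z) (lie (vsval Z0) v)).
  by apply: lie_commute; rewrite fa ?subvsP.
rewrite vE linearZ /= linearZ /= vE !scalerA; congr (_ *: _); ring.
Qed.

(** The set m'_alpha is contained in m_lambda when lambda is the only root above
alpha. All joint eigenvalues mu, on the space V of the proof, of the operators
S Z = - ad Z ad Z0 / alpha(Z0) are roots above alpha, so only lambda occurs. *)
Lemma elementary_root_space m m' a a' (alpha : dual_space a')
    (lambda : dual_space a) X :
  lie_triple_system m -> (m' <= m)%VS -> (a <= m)%VS -> (a' <= a)%VS ->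
  flat_subspace a ->
  alpha <> 0 -> elementary_root m a alpha ->
  lambda \in lts_roots m a -> restrict_form a' lambda = alpha ->
  root_space m' alpha X -> root_space m lambda X.
Proof.
move=> lts m'm am a'a fa alpha0 [l [_ l_unique]] lroot lres rX.
have uniq mu : mu \in lts_roots m a -> restrict_form a' mu = alpha ->
    mu = lambda.
  by move=> mur mures; rewrite -(l_unique mu) // -(l_unique lambda).
have [W0 aW0] := dual_neq0 alpha0.
pose inc (W : subvs_of a') := vsproj a (vsval W).
have incE W : vsval (inc W) = vsval W.
  by rewrite vsprojK // (subvP a'a) ?subvsP.
pose Z0 := inc W0.
have resE mu W : restrict_form a' mu = alpha -> mu (inc W) = alpha W.
  by move=> <-; rewrite restrict_formE.
(* The normalization makes S W act on m'_alpha as alpha W for W in a'. *)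
pose S (Z : subvs_of a) : 'End(g) :=
  (- (alpha W0 : R)^-1) *: (ad (vsval Z) \o ad (vsval Z0))%VF.
have SE Z x : S Z x = - (alpha W0 : R)^-1 *: lie (vsval Z) (lie (vsval Z0) x).
  by rewrite !lfun_simp.
have comm (Z W : subvs_of a) x :
    lie (vsval Z) (lie (vsval W) x) = lie (vsval W) (lie (vsval Z) x).
  by apply: lie_commute; rewrite fa ?subvsP.
have S_comm Z W x : S Z (S W x) = S W (S Z x).
  rewrite !SE !linearZ /=; congr (_ *: (_ *: _)).
  rewrite (comm Z0 W) comm; congr (lie _ _).
  by rewrite comm (comm Z0 Z).
have S_sym Z x y : B (S Z x) y = B x (S Z y).
  rewrite !SE inner_formZl [RHS]inner_form_sym inner_formZl; congr (_ * _).
  by rewrite [RHS]inner_form_sym !inner_form_invariant opprK comm.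
have S_root (mu : dual_space a) v : v \in m -> mu Z0 = alpha W0 ->
    (forall Z, S Z v = (mu Z : R) *: v) -> root_space m mu v.
  move=> vm mu0 Sv; apply: (@root_space_of_polarized _ _ _ Z0); rewrite ?mu0 //.
  move=> Z; rewrite -mulNr -scalerA -Sv SE scalerA mulrNN mulfV //.
  by rewrite scale1r.
have [V VE] := common_kernel (fun W => S (inc W) - (alpha W : R) *: \1%VF) m.
have {}VE x : x \in V <-> x \in m /\ forall W, S (inc W) x = (alpha W : R) *: x.
  rewrite VE; split=> -[xm xE]; split=> // W; have := xE W; rewrite !lfun_simp.
    by move/eqP; rewrite subr_eq0 => /eqP.
  by move=> ->; rewrite subrr.
have SV Z : (S Z @: V <= V)%VS.
  apply/subvP=> _ /memv_imgP[x /VE[xm xE] ->]; apply/VE; split=> [|W].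
    by rewrite SE rpredZ // lts_lie2 // (subvP am) ?subvsP.
  by rewrite S_comm xE linearZ.
have only_l v : v \in V -> v != 0 -> (forall Z, exists t, S Z v = t *: v) ->
    forall Z, S Z v = (lambda Z : R) *: v.
  move=> /VE[vm vE] v0 /choice[t tE].
  have t_lin : linear (t : subvs_of a -> R^o).
    move=> k Z W; apply/eqP; rewrite -subr_eq0.
    have : (t (k *: Z + W) - (k * t Z + t W)) *: v == 0.
      rewrite scalerBl scalerDl -scalerA -!tE !SE linearP /= lieDl lieZl.
      by rewrite scalerDr !scalerA (mulrC k) subrr.
    by rewrite scaler_eq0 (negPf v0) orbF.
  pose tM := GRing.isLinear.Build R _ _ _ (t : _ -> R^o) t_lin.
  pose tL : {linear _ -> _} := HB.pack (t : _ -> R^o) tM.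
  pose mu : dual_space a := linfun tL.
  have muE Z : mu Z = t Z by apply: (lfunE tL).
  have mu_inc W : mu (inc W) = alpha W.
    rewrite muE; apply/eqP; rewrite -subr_eq0.
    have : (t (inc W) - alpha W) *: v == 0 by rewrite scalerBl -tE vE subrr.
    by rewrite scaler_eq0 (negPf v0) orbF.
  have mu_res : restrict_form a' mu = alpha.
    by apply/lfunP=> W; rewrite restrict_formE -mu_inc.
  have <- : mu = lambda; last by move=> Z; rewrite tE muE.
  apply: uniq => //; apply/lts_rootsP; split.
    move=> mu0; move: aW0; rewrite -mu_inc mu0 lfunE /=.
    by rewrite eqxx.
  exists v => //; apply: S_root => [||Z]; [by []|exact: mu_inc|].
  by rewrite tE muE.
have XV : X \in V.
  apply/VE; split=> [|W]; first by apply: (subvP m'm); case: rX.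
  rewrite SE !incE (root_space_polarized _ _ _ _ rX) ?pnatr_eq0 //.
    by rewrite scalerA mulrNN mulrCA mulVf // mulr1.
  by move=> x y xa ya; apply: fa; apply: (subvP a'a).
apply: S_root; first by case/VE: XV.
  exact: resE.
move=> Z; exact: (commuting_selfadjoint_scalar inner_form_linear inner_form_sym
  inner_form_gt0 S_comm S_sym SV only_l).
Qed.

(** With E = [Z0, X], the vector H = [X, E] plays the role of the coroot: it lies
in a, and <Z, H> = <[Z, X], E> is proportional to lambda(Z). *)
Lemma riesz_bracket m a (lambda : dual_space a) (Z0 : subvs_of a) X :
  lie_triple_system m -> cartan_subalgebra m a -> lambda Z0 != 0 ->
  X != 0 -> root_space m lambda X ->
  exists t, riesz c lambda = t *: lie X (lie (vsval Z0) X).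
Proof.
move=> lts ca l0 X0 rX; have [am fa _] := ca; have [Xm _] := rX.
have rX2 (Z W : subvs_of a) : lie (vsval Z) (lie (vsval W) X)
    = - ((lambda Z : R) * lambda W) *: X.
  by apply: root_space_polarized rX; rewrite ?pnatr_eq0.
set E := lie (vsval Z0) X; set H := lie X E.
have E0 : E != 0.
  apply: contra_neq X0 => E0; apply/eqP.
  have /esym/eqP := rX2 Z0 Z0; rewrite -/E E0 linear0 scaler_eq0.
  by rewrite oppr_eq0 mulf_eq0 orbb (negPf l0).
(* The combination W of Z and Z0 is in the kernel of lambda, so ad(W)^2 X = 0;
   then |[W, X]|^2 = - <X, ad(W)^2 X> = 0. *)
have ZX (Z : subvs_of a) :
    (lambda Z0 : R) *: lie (vsval Z) X = (lambda Z : R) *: E.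
  pose W := (lambda Z0 : R) *: Z - (lambda Z : R) *: Z0.
  have WX : lie (vsval W) X =
      (lambda Z0 : R) *: lie (vsval Z) X - (lambda Z : R) *: E.
    by rewrite /W linearB /= linearZ /= lieDl !lieZl lieNl scalerN.
  have lW : lambda W = 0 :> R.
    rewrite /W -scaleNr linearP linearZ.
    by change ((lambda Z0 : R) * lambda Z + - (lambda Z : R) * lambda Z0 = 0); ring.
  apply/eqP; rewrite -subr_eq0 -WX; apply/eqP.
  apply: (form_eq0 inner_form_gt0).
  rewrite inner_form_invariant rX2 lW mul0r oppr0 scale0r inner_form_sym.
  by rewrite (form0l inner_form_linear) oppr0.
have Ha : H \in a.
  apply: (cartan_subalgebra_maximal ca).
    by rewrite lts_lie2 // (subvP am) ?subvsP.
  move=> z za; rewrite -(vsprojK za) lie_derivation rX2 linearZ /= liexx scaler0.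
  rewrite addr0; apply: (scalerI l0).
  by rewrite -lieZl ZX lieZl liexx !scaler0.
exists ((lambda Z0 : R) / B E E); apply: riesz_unique => [|Z].
  by rewrite rpredZ.
have BZr u t v : B u (t *: v) = t * B u v.
  by rewrite ![B u _]inner_form_sym inner_formZl.
rewrite BZr inner_form_sym /H inner_form_invariant lieC -scaleN1r BZr mulN1r opprK.
have BEE : B E E != 0 by rewrite lt0r_neq0 // inner_form_gt0.
rewrite mulrAC -BZr ZX BZr mulfK //.
Qed.

End Compact.

Theorem proposition2p4 (R : realType) (g : lieAlgType R)
    (sigma : 'End(g)) (k m : {vspace g})
    (hsymm : symmetric_decomposition sigma k m)
    (hcompact : killing_negative_definite g)
    (c : R) (hc : 0 < c)
    (m' : {vspace g}) (hm' : (m' <= m)%VS) (hlts : lie_triple_system m')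
    (a : {vspace g}) (ha : cartan_subalgebra m a)
    (ha' : cartan_subalgebra m' (a :&: m')%VS)
    (alpha : dual_space (a :&: m')%VS) (halpha : alpha \in lts_roots m' (a :&: m')%VS) :
  (elementary_root m a alpha ->
     forall lambda : dual_space a,
       lambda \in lts_roots m a -> restrict_form (a :&: m')%VS lambda = alpha ->
       riesz c lambda \in (a :&: m')%VS) /\
  (composite_root m a alpha ->
     forall lambda mu : dual_space a,
       lambda \in lts_roots m a -> mu \in lts_roots m a -> lambda <> mu ->
       restrict_form (a :&: m')%VS lambda = alpha ->
       restrict_form (a :&: m')%VS mu = alpha ->
       forall Z : g, Z \in (a :&: m')%VS ->
         inner_form c (riesz c lambda - riesz c mu) Z = 0).
Proof.
split=> [elem lambda lroot lres|_ lambda mu _ _ _ lres mres Z Za'].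
  have lts := symmetric_decomposition_lts hsymm.
  have [am fa _] := ha.
  have /lts_rootsP[alpha0 [X X0 rX]] := halpha.
  have rXm := elementary_root_space hcompact hc lts hm' am (capvSl a m') fa
    alpha0 elem lroot lres rX.
  have [W aW] := dual_neq0 alpha0.
  have /memv_capP[Wa Wm'] := subvsP W.
  have lW : lambda (vsproj a (vsval W)) != 0 by rewrite -restrict_formE lres.
  have [t rE] := riesz_bracket hcompact hc lts ha lW X0 rXm.
  rewrite memv_cap (proj1 (rieszP hcompact hc lambda)) rE.
  by case: rX => Xm' _; rewrite rpredZ // lts_lie2 // vsprojK.
have /memv_capP[Za _] := Za'.
have rieszE (nu : dual_space a) : restrict_form (a :&: m')%VS nu = alpha ->
    inner_form c (riesz c nu) Z = alpha (vsproj (a :&: m')%VS Z).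
  move=> <-; rewrite restrict_formE !vsprojK // inner_form_sym.
  by have [_ /(_ (vsproj a Z))] := rieszP hcompact hc nu; rewrite vsprojK.
rewrite addrC -scaleN1r inner_form_linear !rieszE //.
by rewrite mulN1r addNr.
Qed.
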